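(* (i) Let $\lambda_0\in(\tfrac12,1)$ be a zero of a $\{0,\pm1\}$ polynomial. Then there exist $\rho=\rho(\lambda_0)<2$ and a constant $C_2>0$ such that for all $N\ge1$, $$|A_N(\lambda_0)|\le C_2\rho^N,$$ where $|A_N(\lambda_0)|$ denotes the number of distinct points of $A_N(\lambda_0)$ (without multiplicities). Consequently, for all $N\ge 1$, $$R_2(0,\lambda_0,2^N)\ge C_2^{-1}(2/\rho)^N-1.$$ (ii) For any interval $I\subset(\tfrac12,1)$ and any $\varepsilon>0$ there is an uncountable set $\mathcal{E}_I\subset I$ such that for every $\lambda\in\mathcal{E}_I$: $$\text{for all } s>0,\quad R_2(s,\lambda,2^N)\ge 2^{N^{1-\varepsilon}}\ \text{ for infinitely many } N.$$
   Context: A $\{0,\pm1\}$ polynomial is a nonzero polynomial all of whose coefficients lie in $\{-1,0,1\}$. For $\lambda\in(0,1)$ and $N\ge1$, let $\Omega_N=\{0,1\}^N$ and for $\omega\in\Omega_N$ put $\pi^N_\lambda(\omega)=(1-\lambda)\sum_{n=0}^{N-1}\omega_n\lambda^n$. The set $A_N(\lambda)=\{\pi^N_\lambda(\omega):\omega\in\Omega_N\}$ is considered with multiplicity ($2^N$ points, one per $\omega$), except where $|A_N(\lambda)|$ explicitly denotes the number of distinct values. The pair correlation function is $$R_2(s,\lambda,2^N)=\frac{1}{2^N}\,\#\Bigl\{(\omega,\tau)\in\Omega_N\times\Omega_N:\ \omega\ne\tau,\ |\pi^N_\lambda(\omega)-\pi^N_\lambda(\tau)|\le \frac{s}{2^N}\Bigr\}.$$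 *)

(* Defs.v *)
From HB Require Import structures.
From mathcomp Require Import all_boot all_order all_algebra.
From mathcomp Require Import all_classical all_reals all_analysis.

Set Implicit Arguments.
Unset Strict Implicit.
Unset Printing Implicit Defensive.

Import Order.TTheory GRing.Theory Num.Theory.
Import numFieldNormedType.Exports.

Local Open Scope classical_set_scope.
Local Open Scope ring_scope.

Definition coef_pm1_poly (R : realType) (p : {poly R}) : Prop :=
  p != 0 /\ forall i : nat, p`_i \in [:: -1; 0; 1].

Definition Omega (N : nat) := {ffun 'I_N -> bool}.

Definition piN (R : realType) (N : nat) (lambda : R) (w : Omega N) : R :=
  (1 - lambda) * \sum_(n < N) (w n)%:R * lambda ^+ n.

(* The 2^N points are listed with multiplicity, one for each word. *)
Definition A (R : realType) (N : nat) (lambda : R) : seq R :=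
  [seq piN lambda w | w : Omega N].

Definition card_distinct_A (R : realType) (N : nat) (lambda : R) : nat :=
  size (undup (A N lambda)).

(* R2 s lambda N stands for R_2(s, lambda, 2^N): the last argument is the
   exponent N, not the number 2^N of points. *)
Definition R2 (R : realType) (s lambda : R) (N : nat) : R :=
  (#|[set wt : Omega N * Omega N | (wt.1 != wt.2) &&
       (`|piN lambda wt.1 - piN lambda wt.2| <= s / 2 ^+ N)]%SET|)%:R / 2 ^+ N.

(* Main.v *)
Require Import Defs.
From HB Require Import structures.
From mathcomp Require Import all_boot all_order all_algebra.
From mathcomp Require Import all_classical all_reals all_analysis.
From mathcomp Require Import ring lra.

Set Implicit Arguments.
Unset Strict Implicit.
Unset Printing Implicit Defensive.

Import Order.TTheory GRing.Theory Num.Theory.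
Import numFieldNormedType.Exports.

Local Open Scope classical_set_scope.
Local Open Scope ring_scope.

(* (i) If p = sum_i a_i X^i is a {0,+-1} polynomial vanishing at l, the words
   1_{a_i = 1} and 1_{a_i = -1} of length m = size p have the same image, so
   every block of m letters yields at most 2^m - 1 values and
   rho = (2^m - 1)^(1/m) works.  Cauchy-Schwarz turns few values into many
   coincidences.
   (ii) Roots of {0,+-1} polynomials are dense in (1/2, 1): truncate the greedy
   expansion of 1 in powers of a given point.  By (i), R_2(0, l0, 2^N) grows
   exponentially at such a root l0, and by continuity
   R_2(s, l, 2^N) >= R_2(0, l0, 2^N) for l near l0.  Hence the good parameters
   contain a countable intersection of dense open subsets of an interval, and
   Baire's theorem forbids such a set to be covered by countably many points. *)

(** * Coincidences of a map on a finite set *)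

Lemma sum_seq_pred1 (R : pzRingType) (V : eqType) (s : seq V) (a : V)
    (g : V -> R) :
  uniq s -> a \in s -> \sum_(v <- s) (a == v)%:R * g v = g a.
Proof.
move=> us sa; rewrite (bigD1_seq a) //= eqxx mul1r big1 ?addr0 // => v /negPf.
by rewrite eq_sym => ->; rewrite mul0r.
Qed.

(* Cauchy-Schwarz in division-free form: summing m_v^2 >= 2 t m_v - t^2 over the
   values v of f, with t still to be optimised (at t = #|T| / #values). *)
Lemma card_collisions_ge (R : realFieldType) (T : finType) (V : eqType)
    (f : T -> V) (t : R) :
  2 * t * #|T|%:R - t ^+ 2 * (size (undup (codom f)))%:R <=
  #|[set xy : T * T | f xy.1 == f xy.2]%SET|%:R.
Proof.
set s := undup _.
have us : uniq s by exact: undup_uniq.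
have sf x : f x \in s by rewrite mem_undup codom_f.
pose m v : R := \sum_x (f x == v)%:R.
have -> : #|T|%:R = \sum_(v <- s) m v :> R.
  rewrite exchange_big /= -sum1_card natr_sum; apply: eq_bigr => x _.
  rewrite -[LHS](@sum_seq_pred1 _ _ s (f x) (fun=> 1)) //.
  by apply: eq_bigr => v _; rewrite mulr1.
have -> : #|[set xy : T * T | f xy.1 == f xy.2]%SET|%:R =
    \sum_(v <- s) m v ^+ 2 :> R.
  rewrite -sum1_card natr_sum big_mkcond /=.
  transitivity (\sum_x \sum_y (f x == f y)%:R : R).
    by rewrite pair_bigA; apply: eq_bigr => -[x y] _; rewrite inE; case: eqP.
  under [RHS]eq_bigr do rewrite expr2 {1}/m mulr_suml.
  rewrite [RHS]exchange_big /=; apply: eq_bigr => x _.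
  rewrite sum_seq_pred1 //; apply: eq_bigr => y _.
  by rewrite eq_sym.
rewrite -sum1_size natr_sum !mulr_sumr -sumrB; apply: ler_sum => v _.
by rewrite mulr1 -subr_ge0 (_ : _ - _ = (m v - t) ^+ 2) ?sqr_ge0 //; ring.
Qed.

(** * Concatenation of words and the number of distinct points *)

Lemma piN_split (R : realType) (N m : nat) (l : R) (w : Omega (m + N)) :
  piN l w = piN l ([ffun i => w (lshift N i)] : Omega m) +
    l ^+ m * piN l ([ffun i => w (rshift m i)] : Omega N).
Proof.
rewrite /piN big_split_ord /= mulrDr mulrCA; congr (_ * _ + _ * _).
  by apply: eq_bigr => i _; rewrite ffunE.
rewrite mulr_sumr; apply: eq_bigr => i _.
by rewrite ffunE exprD mulrCA.
Qed.

Lemma card_Omega (N : nat) : #|{: Omega N}| = (2 ^ N)%N.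
Proof. by rewrite card_ffun card_bool card_ord. Qed.

Lemma size_A (R : realType) (N : nat) (l : R) : size (A N l) = (2 ^ N)%N.
Proof. by rewrite size_map -cardE card_Omega. Qed.

(** Cutting a word after [m] letters writes its value as [a + l ^+ m * b], so the pair [(a, b)]
    determines it. *)
Lemma card_distinct_A_add (R : realType) (N m : nat) (l : R) :
  (card_distinct_A (m + N) l <= card_distinct_A m l * card_distinct_A N l)%N.
Proof.
rewrite /card_distinct_A -(size_allpairs (fun a b => a + l ^+ m * b)).
apply: uniq_leq_size; first exact: undup_uniq.
move=> x; rewrite mem_undup => /mapP[w _ ->]; rewrite piN_split.
by apply: allpairs_f; rewrite mem_undup; apply/mapP;
  eexists; rewrite ?mem_enum.
Qed.

Lemma card_distinct_A_collision (R : realType) (p : {poly R}) (l : R) :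
  coef_pm1_poly p -> root p l -> (card_distinct_A (size p) l < 2 ^ size p)%N.
Proof.
move=> [p0 pc] /rootP pl; rewrite -(size_A _ l) ltn_size_undup.
apply/negP => /injectiveP inj.
pose u : Omega (size p) := [ffun i : 'I_(size p) => p`_i == 1].
pose v : Omega (size p) := [ffun i : 'I_(size p) => p`_i == -1].
have N11 : (1 == -1 :> R) = false by apply/eqP; lra.
have uv : piN l u = piN l v.
  apply/eqP; rewrite -subr_eq0 /piN -mulrBr -sumrB.
  rewrite (eq_bigr (fun i : 'I_(size p) => p`_i * l ^+ i)); last first.
    move=> i _; rewrite !ffunE -mulrBl; congr (_ * _).
    have := pc i; rewrite !inE => /or3P[] /eqP ->.
    - by rewrite eq_sym N11 eqxx sub0r.
    - by rewrite eq_sym oner_eq0 eq_sym oppr_eq0 oner_eq0 subrr.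
    - by rewrite eqxx N11 subr0.
  by rewrite -horner_coef pl mulr0.
(* The two words differ at the index of the leading coefficient, which is nonzero and hence 1 or
   -1. *)
have := inj u v uv.
have sp : (0 < size p)%N by rewrite size_poly_gt0.
have k_lt : ((size p).-1 < size p)%N by rewrite prednK.
move=> /ffunP/(_ (Ordinal k_lt)); rewrite !ffunE /=.
have := pc (size p).-1; rewrite !inE -lead_coefE.
rewrite (negPf (_ : lead_coef p != 0)) ?lead_coef_eq0 //=.
by case/orP => /eqP ->; rewrite eqxx ?N11 // eq_sym N11.
Qed.

(** Divide [N] by [m = size p]: each full block costs a factor [b = 2^m - 1], and the fewer than [m]
    remaining letters cost at most [2^m], which becomes the constant. *)
Lemma card_distinct_A_le (R : realType) (p : {poly R}) (l : R) :
  coef_pm1_poly p -> root p l ->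
  exists rho C : R, [/\ 0 < rho < 2, 0 < C &
    forall N, (card_distinct_A N l)%:R <= C * rho ^+ N].
Proof.
move=> cp pl; have := card_distinct_A_collision cp pl.
have m0 : (0 < size p)%N by rewrite size_poly_gt0; case: cp.
move: m0; set m := size p => m0 Am.
have triv N : (card_distinct_A N l <= 2 ^ N)%N.
  by rewrite -(size_A N l) size_undup.
pose b : R := (2 ^ m).-1%:R.
have b1 : 1 <= b.
  by rewrite ler1n -ltnS prednK ?expn_gt0 // -{1}(expn0 2) ltn_exp2l.
have b0 : 0 < b by exact: lt_le_trans b1.
pose rho := b `^ (m%:R^-1).
have rho0 : 0 < rho by exact: powR_gt0.
have rhom : rho ^+ m = b.
  by rewrite -powR_mulrn ?ltW // -powRrM mulVf ?powRr1 ?ltW // pnatr_eq0 -lt0n.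
(* This lets [2 ^+ m] alone pay for the incomplete block. *)
have rho1 : 1 <= rho by rewrite -(@expr_ge1 _ m) ?rhom // ltW.
exists rho, (2 ^+ m); split; rewrite ?exprn_gt0 //.
  rewrite rho0 /= -(@ltr_pXn2r _ m) ?nnegrE ?ltW // rhom.
  by rewrite -natrX ltr_nat prednK ?expn_gt0.
move=> N; rewrite {1}(divn_eq N m).
have -> : rho ^+ N = b ^+ (N %/ m) * rho ^+ (N %% m).
  by rewrite -rhom -exprM mulnC -exprD -divn_eq.
elim: (N %/ m)%N => [|q IH].
  rewrite expr0 mul1r mul0n add0n; apply: (@le_trans _ _ (2 ^+ m)).
    rewrite -natrX ler_nat (leq_trans (triv _)) // leq_exp2l //.
    by rewrite ltnW // ltn_mod.
  by rewrite ler_peMr ?exprn_ge0 // exprn_ege1.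
rewrite mulSn -addnA.
apply: (@le_trans _ _ (b * (card_distinct_A (q * m + N %% m) l)%:R)).
  rewrite -natrM ler_nat (leq_trans (card_distinct_A_add _ _ _)) // leq_mul2r.
  by apply/orP; right; rewrite -ltnS prednK ?expn_gt0.
by rewrite exprS -mulrA mulrCA ler_pM2l.
Qed.

(** * Lower bounds for the pair correlation at a root and near it *)

Lemma R2_0_ge (R : realType) (N : nat) (l K : R) :
  0 < K -> (card_distinct_A N l)%:R <= K -> 2 ^+ N / K - 1 <= R2 0 l N.
Proof.
move=> K0 AK; have T0 : 0 < 2 ^+ N :> R by rewrite exprn_gt0.
rewrite /R2 mul0r ler_pdivlMr // mulrBl mul1r lerBlDr.
(* With [t = 2^N / K] an upper bound [K] on the number of values suffices: the left side is then at
   least [t * 2^N]. *)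
have := card_collisions_ge (@piN R N l) (2 ^+ N / K).
rewrite card_Omega natrX => /(le_trans _)-/(_ (2 ^+ N / K * 2 ^+ N)) h.
apply: (le_trans (h _)).
  have : (2 ^+ N / K) ^+ 2 * (card_distinct_A N l)%:R <= (2 ^+ N / K) ^+ 2 * K.
    by rewrite ler_wpM2l ?sqr_ge0.
  rewrite [X in _ <= X](_ : _ = 2 ^+ N / K * 2 ^+ N); last first.
    by field; rewrite gt_eqF.
  rewrite /card_distinct_A /A /codom; lra.
(* The collision count includes the [2^N] diagonal pairs, which [R2] excludes; they account for the
   [- 1]. *)
rewrite -natrX -natrD ler_nat -card_Omega.
rewrite -[in X in (_ <= X)%N]cardsT.
apply: leq_trans (leq_add (leqnn _) (leq_imset_card (fun w => (w, w)) _)).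
apply: leq_trans (leq_card_setU _ _).1.
apply/subset_leq_card/fintype.subsetP => -[w t].
rewrite !inE /= normr_le0 subr_eq0 => ->; rewrite andbT.
by have [<-|//] := eqVneq w t; apply/imsetP; exists w; rewrite ?inE.
Qed.

Lemma R2_0_ge_exp (R : realType) (N : nat) (l C rho : R) :
  0 < C -> 0 < rho -> (card_distinct_A N l)%:R <= C * rho ^+ N ->
  C^-1 * (2 / rho) ^+ N - 1 <= R2 0 l N.
Proof.
move=> C0 r0 /R2_0_ge; rewrite mulr_gt0 ?exprn_gt0 // => /(_ isT).
by rewrite invfM expr_div_n mulrCA.
Qed.

(** By continuity, each pair of words that coincides at [l0] stays within [s / 2 ^+ N] near [l0];
    finitely many pairs share one neighbourhood. *)
Lemma R2_0_le_near (R : realType) (N : nat) (l0 s : R) : 0 < s ->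
  \forall l \near l0, R2 0 l0 N <= R2 s l N.
Proof.
move=> s0; have d0 : 0 < s / 2 ^+ N by rewrite divr_gt0 // exprn_gt0.
have cont (w : Omega N) : {for l0, continuous (fun l : R => piN l w)}.
  pose p : {poly R} := (1 - 'X) * \sum_(n < N) (w n)%:R *: 'X^n.
  rewrite (_ : (fun _ => _) = horner p); first exact: continuous_horner.
  apply/funext => l; rewrite /p !hornerE horner_sum; congr (_ * _).
  by apply: eq_bigr => i _; rewrite !hornerE.
have H : \forall l \near l0, forall wt : Omega N * Omega N,
    piN l0 wt.1 = piN l0 wt.2 -> `|piN l wt.1 - piN l wt.2| <= s / 2 ^+ N.
  apply: (@filter_forall R (Omega N * Omega N)%type (fun wt l =>
    piN l0 wt.1 = piN l0 wt.2 -> `|piN l wt.1 - piN l wt.2| <= s / 2 ^+ N)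
    (nbhs l0)).
  move=> -[w t] /=.
  have [e|] := eqVneq (piN l0 w) (piN l0 t); last first.
    by move=> /eqP ne; apply: nearW.
  have /cvgr_dist_le/(_ _ d0) : piN l w - piN l t @[l --> l0] -->
      (piN l0 w - piN l0 t : R).
    by apply: cvgB; exact: cont.
  by apply: filterS => l; rewrite e subrr sub0r normrN.
apply: filterS H => l H; rewrite /R2 ler_pM2r ?invr_gt0 ?exprn_gt0 // ler_nat.
rewrite subset_leq_card //; apply/fintype.subsetP => -[w t].
rewrite !inE /= mul0r normr_le0 subr_eq0 => /andP[-> /eqP e] /=.
exact: (H (w, t)).
Qed.

(** * Greedy expansions of 1 and density of the roots *)

Fixpoint greedy_poly (R : realType) (l : R) (n : nat) : {poly R} :=
  if n is n'.+1 then
    let p := greedy_poly l n' in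
    if l ^+ n <= p.[l] then p - 'X^n else p
  else 1.

Lemma greedy_poly_coef (R : realType) (l : R) (n : nat) :
  [/\ forall i, (greedy_poly l n)`_i \in [:: -1; 0; 1],
      forall i, (n < i)%N -> (greedy_poly l n)`_i = 0 &
      (greedy_poly l n)`_0 = 1].
Proof.
elim: n => [|n [IH1 IH2 IH3]] /=.
  split=> [i|[]// i _|]; rewrite coef1 //=.
  by rewrite !inE; case: (i == 0)%N; rewrite eqxx ?orbT.
case: ifP => _; last by split=> // i ni; rewrite IH2 // ltnW.
split=> [i|i ni|].
- rewrite coefB coefXn; case: eqP => [->|_]; last by rewrite subr0.
  by rewrite IH2 // sub0r inE eqxx.
- by rewrite coefB coefXn IH2 ?gtn_eqF ?subrr // ltnW.
- by rewrite coefB coefXn subr0.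
Qed.

(* Since l >= 1/2, the greedy remainder stays below the next power of l. *)
Lemma greedy_poly_remainder (R : realType) (l : R) (n : nat) :
  2^-1 <= l <= 1 -> 0 <= (greedy_poly l n).[l] <= l ^+ n.
Proof.
move=> /andP[l2 l1]; elim: n => [|n /andP[IH0 IH1]] /=.
  by rewrite hornerC expr0 ler01 lexx.
have ln0 : 0 <= l ^+ n by rewrite exprn_ge0 // (le_trans _ l2).
case: ifPn => [le|]; last by rewrite -ltNge => /ltW ->; rewrite IH0.
rewrite !hornerE subr_ge0 le /= exprS; move: IH1; nra.
Qed.

(* The first digit is always 1, so - 'X is among the monomials. *)
Lemma greedy_poly_decr (R : realType) (l x : R) (n : nat) :
  0 <= l <= 1 -> l <= x ->
  (greedy_poly l n.+1).[x] <= (greedy_poly l n.+1).[l] - (x - l).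
Proof.
move=> /andP[l0 l1] lx; elim: n => [|n IH].
  by rewrite /= hornerC expr1 l1 !hornerE; lra.
have e (m : nat) : greedy_poly l m.+1 =
  if l ^+ m.+1 <= (greedy_poly l m).[l]
  then greedy_poly l m - 'X^(m.+1) else greedy_poly l m by [].
rewrite e; case: ifP => // _; rewrite !hornerE.
have : l ^+ n.+2 <= x ^+ n.+2 by rewrite lerXn2r ?nnegrE // (le_trans l0).
move: IH; lra.
Qed.

(** The greedy polynomial of the midpoint [m] has a remainder in [[0, m ^+ n.+1]] at [m] and drops
    by at least [c - m] on the way to [c]. Once [m ^+ n.+1 < c - m], it changes sign on [[m, c]],
    which lies strictly inside []a, b[]. *)
Lemma pm1_root_dense (R : realType) (a b : R) : 2^-1 <= a -> a < b -> b <= 1 ->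
  exists l : R, a < l < b /\ exists p : {poly R}, coef_pm1_poly p /\ root p l.
Proof.
move=> a2 ab b1; pose m := (a + b) / 2; pose c := (m + b) / 2.
have [am mc cb] : [/\ a < m, m < c & c < b] by rewrite /c /m; split; lra.
have m01 : 0 < m < 1 by rewrite /m; apply/andP; split; lra.
have /cvgr_lt/(_ _ (_ : 0 < c - m)) : geometric 1 m n @[n --> \oo] --> (0 : R).
  by apply: cvg_geometric; rewrite gtr0_norm; case/andP: m01.
(* The index is [n.+1] because the decrease requires the first digit to have been subtracted. *)
rewrite subr_gt0 => /(_ mc)[n _ /(_ n.+1 (leqnSn n))] /=; rewrite mul1r => mn.
have /andP[r0 r1] : 0 <= (greedy_poly m n.+1).[m] <= m ^+ n.+1.
  by apply: greedy_poly_remainder; apply/andP; split; move: m01; lra.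
have pc : (greedy_poly m n.+1).[c] <= 0.
  have := @greedy_poly_decr _ m c n _ (ltW mc).
  move=> /(_ _)/le_trans; apply; last lra.
  by move: m01 => /andP[/ltW -> /ltW ->].
have [|l /andP[ml lc] rl] := @poly_ivt R (- greedy_poly m n.+1) m c (ltW mc).
  by rewrite !hornerN oppr_le0 oppr_ge0 r0.
exists l; split; first by rewrite (lt_le_trans am) // (le_lt_trans lc).
have [h1 _ h3] := greedy_poly_coef m n.+1.
exists (greedy_poly m n.+1); split; last by rewrite -rootN.
split=> //; apply/eqP => h; move: h3; rewrite h coef0 => /eqP.
by rewrite eq_sym oner_eq0.
Qed.

(** * Exponential against subexponential growth *)

Lemma powR_subexp_near (R : realType) (rho C eps : R) :
  0 < rho < 2 -> 0 < C -> 0 < eps ->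
  \forall N \near \oo, 2 `^ (N%:R `^ (1 - eps)) <= C^-1 * (2 / rho) ^+ N - 1.
Proof.
move=> /andP[r0 r2] C0 e0.
have q1 : 1 < 2 / rho by rewrite ltr_pdivlMr // mul1r.
have lq : 0 < ln (2 / rho) by rewrite ln_gt0.
have l2 : 0 < ln (2 : R) by rewrite ln_gt0 // ltr1n.
(* After taking logarithms, [c] allots half of the exponential rate to [y]; the other half absorbs
   [ln 2 + ln C] in [Nb]. *)
pose c := ln (2 / rho) / (2 * ln 2).
have c0 : 0 < c by rewrite divr_gt0 // mulr_gt0.
near=> N.
have N1 : 1 <= N%:R :> R by near: N; exact: nbhs_infty_ger.
have N0 : 0 < N%:R :> R by exact: lt_le_trans N1.
set y := _ `^ (1 - eps); have y0 : 0 <= y by exact: powR_ge0.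
have yc : y <= N%:R * c.
  rewrite /y powRD; last by rewrite (gt_eqF N0) implybT.
  rewrite powRr1 ?ler0n // ler_pM2l // powRN.
  (* The bound [N^(-eps) <= c] follows from [(c^-1)^(1/eps) <= N], true for large [N]. *)
  rewrite invf_ple ?posrE ?powR_gt0 //.
  rewrite (_ : c^-1 = (c^-1 `^ eps^-1) `^ eps); last first.
    by rewrite -powRrM mulVf ?gt_eqF // powRr1 // invr_ge0 ltW.
  apply: ge0_ler_powR; rewrite ?nnegrE ?powR_ge0 ?(ltW e0) //.
  by near: N; exact: nbhs_infty_ger.
have Nb : ln 2 + ln C <= N%:R * (ln (2 / rho) / 2).
  rewrite -ler_pdivrMr ?divr_gt0 //; near: N; exact: nbhs_infty_ger.
have p1 : 1 <= 2 `^ y by rewrite -[leLHS](powRr0 2) ler_powR // ler1n.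
(* Since [1 <= 2^y], the [- 1] costs at most a factor 2. *)
rewrite lerBrDr; apply: (@le_trans _ _ (2 * 2 `^ y)); first by lra.
have qN : 0 < (2 / rho) ^+ N by rewrite exprn_gt0 // (lt_trans ltr01).
rewrite [leRHS]mulrC ler_pdivlMr //.
rewrite -ler_ln ?posrE ?mulr_gt0 ?powR_gt0 //.
rewrite !lnM ?posrE ?mulr_gt0 ?powR_gt0 //.
rewrite ln_powR lnXn ?(lt_trans ltr01) // -[leRHS]mulr_natl.
have : y * ln 2 <= N%:R * (ln (2 / rho) / 2).
  suff -> : N%:R * (ln (2 / rho) / 2) = N%:R * c * ln 2 by rewrite ler_pM2r.
  by rewrite /c; field; rewrite gt_eqF.
lra.
Unshelve. all: by end_near. Qed.

(** * Open dense sets of good parameters and Baire's theorem *)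

Lemma unbounded_infinite_set (P : set nat) :
  (forall k, exists2 n, (k <= n)%N & P n) -> infinite_set P.
Proof.
move=> h /finite_seqP[s Ps]; have [n] := h (\max_(i <- s) i).+1.
by rewrite Ps /= ltnNge => /negP nmax ns; apply: nmax; exact: leq_bigmax_seq.
Qed.

Lemma R2_le (R : realType) (N : nat) (l s t : R) :
  s <= t -> R2 s l N <= R2 t l N.
Proof.
move=> st; rewrite /R2 ler_pM2r ?invr_gt0 ?exprn_gt0 // ler_nat.
rewrite subset_leq_card //; apply/fintype.subsetP => wt.
rewrite !inE => /andP[-> /=].
by move=> /le_trans; apply; rewrite ler_pM2r // invr_gt0 exprn_gt0.
Qed.

Definition large_R2 (R : realType) (eps l s : R) (N : nat) : Prop :=
  2 `^ (N%:R `^ (1 - eps)) <= R2 s l N.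

(** The interior makes these sets open by construction. The single index [k] bounds [N] below and
    sets the scale [1/(k+1)], so countably many sets handle every [s > 0] and arbitrarily large
    [N]. *)
Definition large_R2_after (R : realType) (eps : R) (k : nat) : set R :=
  [set l | exists2 N, (k <= N)%N & large_R2 eps l k.+1%:R^-1 N]°.

(** Exponential growth at the root passes the threshold at some [N >= k]; for this fixed [N] the
    bound persists on a neighbourhood, so the root is an interior point. *)
Lemma large_R2_after_root (R : realType) (eps : R) (k : nat) (l : R)
    (p : {poly R}) : 0 < eps -> coef_pm1_poly p -> root p l ->
  large_R2_after eps k l.
Proof.
move=> e0 cp pl; have [rho [C [r02 C0 AC]]] := card_distinct_A_le cp pl.
have [N [kN hN]] : exists N, (k <= N)%N /\
    2 `^ (N%:R `^ (1 - eps)) <= C^-1 * (2 / rho) ^+ N - 1.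
  have H := powR_subexp_near r02 C0 e0.
  near \oo => N; exists N; split; near: N => //.
  exact: nbhs_infty_ge.
have k0 : 0 < k.+1%:R^-1 :> R by rewrite invr_gt0.
rewrite /large_R2_after /interior /=.
apply: filterS (R2_0_le_near N l k0) => l' h.
exists N => //; apply: le_trans h; apply: (le_trans hN).
by have /andP[r0 _] := r02; exact: R2_0_ge_exp.
Unshelve. all: by end_near. Qed.

(** Adding the complement of [[a, b]] gives density in the whole line, as Baire's theorem requires.
    An open set inside [[a, b]] contains an interval, hence a root. *)
Lemma large_R2_after_dense (R : realType) (eps a b : R) (k : nat) :
  0 < eps -> 2^-1 <= a -> b <= 1 ->
  dense (large_R2_after eps k `|` ~` `[a, b]).
Proof.
move=> e0 a2 b1 O [x Ox] oO.
have [Oab|] := pselect (O `<=` `[a, b]); last first.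
  move=> /existsNP[y /not_implyP[Oy yab]].
  by exists y; split=> //; right.
have /nbhs_ballP[e /= e0' eO] : nbhs x O by apply: open_nbhs_nbhs.
have xe y : x <= y -> y < x + e -> O y.
  move=> xy ye; apply: eO; rewrite /ball /= distrC ger0_norm ?subr_ge0 //; lra.
(* Both [x] and [x + e / 2] lie in [O], hence in [[a, b]], which puts the interval between them in
   the range where roots are dense. *)
have /Oab := Ox; rewrite /= in_itv /= => /andP[ax _].
have /Oab : O (x + e / 2) by apply: xe; move: e0'; lra.
rewrite /= in_itv /= => /andP[_ xb].
have [||| l [/andP[xl lx] [p [cp pl]]]] := @pm1_root_dense R x (x + e / 2).
- exact: le_trans a2 ax.
- by move: e0'; lra.
- exact: le_trans xb b1.
exists l; split; last by left; exact: large_R2_after_root pl.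
by apply: xe; move: e0'; lra.
Qed.

(** Inclusion rather than equality accommodates the empty set, for which a constant sequence
    serves. *)
Lemma countable_range (T : pointedType) (E : set T) : countable E ->
  exists c : nat -> T, E `<=` range c.
Proof.
move=> /pfcard_geP[->|[f]]; first by exists (fun=> point).
by exists f; exact: surj.
Qed.

Theorem theorem2p2 (R : realType) :
  (forall lambda0 : R, 2^-1 < lambda0 < 1 ->
     (exists p : {poly R}, coef_pm1_poly p /\ root p lambda0) ->
     exists rho C2 : R,
       [/\ rho < 2, 0 < C2,
           (forall N : nat, (1 <= N)%N ->
              (card_distinct_A N lambda0)%:R <= C2 * rho ^+ N) &
           (forall N : nat, (1 <= N)%N ->
              C2^-1 * (2 / rho) ^+ N - 1 <= R2 0 lambda0 N)])
  /\
  (forall (I : set R) (eps : R),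
     is_interval I -> I° !=set0 ->
     I `<=` [set x : R | 2^-1 < x < 1] -> 0 < eps ->
     exists E : set R,
       [/\ E `<=` I, ~ countable E &
           forall lambda : R, E lambda ->
             forall s : R, 0 < s ->
               infinite_set [set N : nat |
                 2 `^ (N%:R `^ (1 - eps)) <= R2 s lambda N]]).
Proof.
split.
  move=> l _ [p [cp pl]].
  have [rho [C [/andP[r0 r2] C0 AC]]] := card_distinct_A_le cp pl.
  by exists rho, C; split=> // N _; exact: R2_0_ge_exp.
move=> I eps _ [x] /nbhs_ballP[e /= e0 eI] I12 eps0.
(* Half the radius keeps the closed interval [[a, b]] inside the ball, hence inside [I]. *)
pose a := x - e / 2; pose b := x + e / 2.
have abI y : a <= y <= b -> I y.
  move=> yab; apply: eI; rewrite /ball /= ltr_norml.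
  by move: yab e0; rewrite /a /b; lra.
have /andP[a2 _] : 2^-1 < a < 1.
  by apply: I12; apply: abI; move: e0; rewrite /a /b; lra.
have /andP[_ b1] : 2^-1 < b < 1.
  by apply: I12; apply: abI; move: e0; rewrite /a /b; lra.
(* All good parameters of [I] are taken, so only uncountability remains to be shown. *)
exists (I `&`
  [set l | forall s, 0 < s -> infinite_set [set N | large_R2 eps l s N]]).
split; [by move=> l [] | | by move=> l []].
move=> /countable_range[c Ec].
(* Removing [c n] keeps the set open and dense. A point of []a, b[] in every [U n] is a good
   parameter missed by the enumeration [c]. *)
pose U n := (large_R2_after eps n `|` ~` `[a, b]) `&` ~` [set c n].
have Uo n : open (U n) /\ dense (U n).
  have oG : open (large_R2_after eps n `|` ~` `[a, b]).
    by apply: openU; [exact: open_interior | exact/closed_openC/itv_closed].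
  split; first by apply: openI => //; apply/closed_openC/closed_eq.
  apply: denseI => //; last exact: dense_set1C.
  by apply: large_R2_after_dense => //; exact: ltW.
have [||l [lab lU]] := Baire Uo (O := `]a, b[%classic).
- by exists x; rewrite /= in_itv /=; move: e0; rewrite /a /b; lra.
- exact: itv_open.
have {}lab : a <= l <= b.
  by move: lab; rewrite /= in_itv /= => /andP[/ltW -> /ltW ->].
have [n _ cn] : range c l.
  apply: Ec; split; first exact: abI.
  move=> s s0; apply: unbounded_infinite_set => k.
  (* Membership in [U m] then gives an [N >= m >= k] at scale [1/(m+1) < s], and [R2] is monotone in
     the scale. *)
  have [m [km ms]] : exists m, (k <= m)%N /\ m.+1%:R^-1 < s.
    have H := near_infty_natSinv_lt (PosNum s0).
    near \oo => m; exists m; split; near: m => //; exact: nbhs_infty_ge.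
  have [[/interior_subset[N mN h]|nab] _] := lU m Logic.I; last first.
    by exfalso; apply: nab; rewrite /= in_itv /= lab.
  exists N; first exact: leq_trans mN.
  exact: le_trans h (R2_le _ _ (ltW ms)).
by have [_ /(_ (esym cn))] := lU n Logic.I.
Unshelve. all: by end_near. Qed.
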